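(* Let $A, B\in \mathbb{C}^{m\times n}$ be such that $A^*B=0$ (that is, $A$ is left $*$-orthogonal to $B$). Then $(A+B)^\dagger=A^\dagger + B^\dagger$ if and only if $(I_m-P_A)BA^*=0$.
   Context: $M^*$ is the conjugate transpose and $M^\dagger$ the Moore-Penrose inverse of $M$; $P_A=AA^\dagger$ is the orthogonal projector onto the column space of $A$. *)

(* Defs.v *)
From HB Require Import structures.
From mathcomp Require Import all_boot all_order all_algebra.
From mathcomp Require Import spectral sesquilinear.

Set Implicit Arguments.
Unset Strict Implicit.
Unset Printing Implicit Defensive.

Import Order.TTheory GRing.Theory Num.Theory.
Local Open Scope ring_scope.
Local Open Scope sesquilinear_scope.

Section MoorePenrose.
Variable C : numClosedFieldType.

Lemma adjmxM m n p (A : 'M[C]_(m, n)) (B : 'M[C]_(n, p)) :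
  (A *m B) ^t* = B ^t* *m A ^t*.
Proof. by rewrite trmx_mul map_mxM. Qed.

Lemma mulmx_adj_eq0 m n (A : 'M[C]_(m, n)) : A *m A ^t* = 0 -> A = 0.
Proof.
move=> AA0; apply/matrixP => i j; rewrite mxE; apply/eqP.
have /eqP := congr1 (fun M : 'M_m => M i i) AA0; rewrite !mxE.
rewrite psumr_eq0 => [/allP/(_ j)|k _]; rewrite !mxE ?mul_conjC_ge0 //.
by rewrite mem_index_enum mul_conjC_eq0 => /(_ isT).
Qed.

Lemma gram_unitmx m n (A : 'M[C]_(m, n)) :
  row_free A -> A *m A ^t* \in unitmx.
Proof.
move=> freeA; rewrite -row_free_unit -kermx_eq0; apply/eqP.
set K := kermx _; have K0 : K *m (A *m A ^t*) = 0 by exact: mulmx_ker.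
apply: (row_free_inj freeA); rewrite /= mul0mx; apply: mulmx_adj_eq0.
by rewrite adjmxM mulmxA -(mulmxA K) K0 mul0mx.
Qed.

Definition penrose m n (A : 'M[C]_(m, n)) (X : 'M[C]_(n, m)) : bool :=
  [&& A *m X *m A == A,
      X *m A *m X == X,
      (A *m X) ^t* == A *m X
    & (X *m A) ^t* == X *m A].

Lemma penrose_unique m n (A : 'M[C]_(m, n)) (X Y : 'M[C]_(n, m)) :
  penrose A X -> penrose A Y -> X = Y.
Proof.
move=> /and4P[/eqP X1 /eqP X2 /eqP X3 /eqP X4].
move=> /and4P[/eqP Y1 /eqP Y2 /eqP Y3 /eqP Y4].
have AXY : A *m X = A *m Y.
  by rewrite -X3 -[in LHS]Y1 -(mulmxA _ A X) adjmxM X3 Y3 mulmxA X1.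
have XYA : X *m A = Y *m A.
  by rewrite -X4 -[in LHS]Y1 -(mulmxA A) mulmxA adjmxM X4 Y4 -mulmxA
             (mulmxA A) X1.
by rewrite -X2 XYA -mulmxA AXY mulmxA Y2.
Qed.

(* From a rank factorization A = F G, the Moore-Penrose inverse is
   G^* (G G^* )^-1 (F^* F)^-1 F^*. *)
Lemma penrose_exists m n (A : 'M[C]_(m, n)) : exists X, penrose A X.
Proof.
have [r [F [G [-> uF uG]]]] : exists r (F : 'M[C]_(m, r)) (G : 'M[C]_(r, n)),
    [/\ A = F *m G, F ^t* *m F \in unitmx & G *m G ^t* \in unitmx].
  exists (\rank A), (col_base A), (row_base A); split.
  - by rewrite mulmx_base.
  - rewrite -{2}[col_base A]trmxCK; apply: gram_unitmx.
    by rewrite row_free_map /row_free mxrank_tr; exact: col_base_full.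
  - by apply: gram_unitmx; exact: row_base_free.
set f := F ^t* *m F in uF *; set g := G *m G ^t* in uG *.
have fE : f ^t* = f by rewrite adjmxM trmxCK.
have gE : g ^t* = g by rewrite adjmxM trmxCK.
have ifE : (invmx f) ^t* = invmx f by rewrite trmx_inv map_invmx fE.
have igE : (invmx g) ^t* = invmx g by rewrite trmx_inv map_invmx gE.
set X := G ^t* *m invmx g *m (invmx f *m F ^t*).
have AX : F *m G *m X = F *m invmx f *m F ^t*.
  by rewrite /X !mulmxA -(mulmxA F G) -/g -(mulmxA F g) mulmxV // mulmx1.
have XA : X *m (F *m G) = G ^t* *m invmx g *m G.
  rewrite /X -!mulmxA (mulmxA (F ^t*)) -/f (mulmxA (invmx f)) mulVmx //.
  by rewrite mul1mx.
exists X; apply/and4P; split; apply/eqP.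
- by rewrite AX -!mulmxA (mulmxA (F ^t*)) -/f (mulmxA (invmx f)) mulVmx //
             mul1mx.
- rewrite XA /X !mulmxA -(mulmxA (_ *m invmx g) G) -/g.
  by rewrite -(mulmxA (G ^t*) (invmx g) g) mulVmx // mulmx1.
- by rewrite AX !adjmxM trmxCK ifE mulmxA.
- by rewrite XA !adjmxM trmxCK igE mulmxA.
Qed.

Definition mpinv m n (A : 'M[C]_(m, n)) : 'M[C]_(n, m) :=
  xchoose (penrose_exists A).

Lemma mpinvP m n (A : 'M[C]_(m, n)) : penrose A (mpinv A).
Proof. exact: xchooseP. Qed.

Lemma mpinv_eq m n (A : 'M[C]_(m, n)) (X : 'M[C]_(n, m)) :
  penrose A X -> mpinv A = X.
Proof. by move=> AX; exact: penrose_unique (mpinvP A) AX. Qed.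

Definition colproj m n (A : 'M[C]_(m, n)) : 'M[C]_m := A *m mpinv A.

End MoorePenrose.

(* Main.v *)
(* Since A^* B = 0, the projector P_A kills B, so the condition reads
   B A^* = 0; moreover A^+ B = 0 and B^+ A = 0, whence
   (A^+ + B^+)(A + B) = A^+ A + B^+ B.  If A^+ + B^+ is the Moore-Penrose
   inverse of A + B, this sum of two hermitian projectors is idempotent, which
   forces them to be orthogonal, and B A^* = B (B^+ B) (A^+ A) A^* = 0.
   Conversely B A^* = 0 kills all the cross terms in the Penrose equations. *)
Require Import Defs.
From mathcomp Require Import all_boot all_order all_algebra.
From mathcomp Require Import spectral sesquilinear complex reals.

Set Implicit Arguments.
Unset Strict Implicit.

Import GRing.Theory Num.Theory.
Local Open Scope ring_scope.
Local Open Scope sesquilinear_scope.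

Section StarOrthogonal.
Context {C : numClosedFieldType}.

Lemma adjmxD m n (A B : 'M[C]_(m, n)) : (A + B) ^t* = A ^t* + B ^t*.
Proof. by rewrite linearD map_mxD. Qed.

Lemma adjmx0 m n : (0 : 'M[C]_(m, n)) ^t* = 0.
Proof. by rewrite trmx0 map_mx0. Qed.

Lemma mulmx_adj_eq0C m n p (A : 'M[C]_(m, n)) (B : 'M[C]_(p, n)) :
  A *m B ^t* = 0 -> B *m A ^t* = 0.
Proof.
by move=> AB0; rewrite -[B *m _]trmxCK adjmxM trmxCK AB0 adjmx0.
Qed.

(** Makes the hypothesis symmetric in A and B, so that B^+ A = 0 follows just like A^+ B = 0. *)
Lemma adj_mulmx_eq0C m n p (A : 'M[C]_(m, n)) (B : 'M[C]_(m, p)) :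
  A ^t* *m B = 0 -> B ^t* *m A = 0.
Proof. by move=> AB0; rewrite -[_ *m A]trmxCK adjmxM trmxCK AB0 adjmx0. Qed.

(** Since A A^+ is hermitian, A^+ = A^+ A A^+ = A^+ (A^+)^* A^* has A^* as its last factor. *)
Lemma mpinv_mul_eq0 m n p (A : 'M[C]_(m, n)) (B : 'M[C]_(m, p)) :
  A ^t* *m B = 0 -> mpinv A *m B = 0.
Proof.
move=> AB0; have /and4P[_ /eqP XAX /eqP AXh _] := mpinvP A.
by rewrite -XAX -(mulmxA _ A) -AXh adjmxM -!mulmxA AB0 !mulmx0.
Qed.

(** Since A^+ A is hermitian, A^+ = A^* (A^+)^* A^+ has A^* as its first factor. *)
Lemma mul_mpinv_eq0 m n p (A : 'M[C]_(m, n)) (B : 'M[C]_(p, n)) :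
  B *m A ^t* = 0 -> B *m mpinv A = 0.
Proof.
move=> BA0; have /and4P[_ /eqP XAX _ /eqP XAh] := mpinvP A.
by rewrite -XAX -XAh adjmxM !mulmxA BA0 !mul0mx.
Qed.

(** Adjoint of A A^+ A = A, with A^+ A hermitian. *)
Lemma mpinv_mul_adj m n (A : 'M[C]_(m, n)) : mpinv A *m A *m A ^t* = A ^t*.
Proof.
have /and4P[/eqP AXA _ _ /eqP XAh] := mpinvP A.
by rewrite -XAh -adjmxM mulmxA AXA.
Qed.

Lemma mpinv_mul_idem m n (A : 'M[C]_(m, n)) :
  (mpinv A *m A) *m (mpinv A *m A) = mpinv A *m A.
Proof. by have /and4P[_ /eqP XAX _ _] := mpinvP A; rewrite mulmxA XAX. Qed.

(* The idempotency of P + Q gives PQ + QP = 0; multiplying it by P on either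
   side yields PQ = - PQP = QP, hence 2 QP = 0. *)
Lemma idempotent_add_orthogonal n (P Q : 'M[C]_n) :
  P *m P = P -> Q *m Q = Q -> (P + Q) *m (P + Q) = P + Q -> Q *m P = 0.
Proof.
move=> PP QQ; rewrite mulmxDl !mulmxDr PP QQ => PQi.
have anti : P *m Q = - (Q *m P).
  apply/eqP; rewrite -addr_eq0; apply/eqP/(addrI (P + Q)).
  by rewrite addr0 -[RHS]PQi addrACA (addrC Q).
have PQ : P *m Q = - (P *m Q *m P).
  by rewrite -{1}PP -mulmxA {1}anti mulmxN mulmxA.
have QP : Q *m P = - (P *m Q *m P).
  by rewrite anti mulNmx opprK -mulmxA PP.
have : 2%:R *: (Q *m P) == 0.
  by rewrite scaler_nat mulr2n {1}QP -PQ anti addNr.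
by rewrite scalemx_eq0 pnatr_eq0 => /eqP.
Qed.

Lemma mpinvD_of_star_orthogonal m n (A B : 'M[C]_(m, n)) :
  A ^t* *m B = 0 -> B *m A ^t* = 0 -> mpinv (A + B) = mpinv A + mpinv B.
Proof.
move=> AB0 BA0; apply: mpinv_eq.
have XB := mpinv_mul_eq0 AB0; have YA := mpinv_mul_eq0 (adj_mulmx_eq0C AB0).
have BX := mul_mpinv_eq0 BA0; have AY := mul_mpinv_eq0 (mulmx_adj_eq0C BA0).
have /and4P[/eqP AXA /eqP XAX /eqP AXh /eqP XAh] := mpinvP A.
have /and4P[/eqP BYB /eqP YBY /eqP BYh /eqP YBh] := mpinvP B.
(* All four mixed products vanish, so each product of the two sums splits into two hermitian
   projectors. *)
have MN : (A + B) *m (mpinv A + mpinv B) = A *m mpinv A + B *m mpinv B.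
  by rewrite mulmxDl !mulmxDr AY BX addr0 add0r.
have NM : (mpinv A + mpinv B) *m (A + B) = mpinv A *m A + mpinv B *m B.
  by rewrite mulmxDl !mulmxDr XB YA addr0 add0r.
apply/and4P; split; apply/eqP.
- rewrite MN mulmxDl !mulmxDr AXA BYB -!mulmxA XB YA !mulmx0.
  by rewrite addr0 add0r.
- rewrite NM mulmxDl !mulmxDr XAX YBY -!mulmxA AY BX !mulmx0.
  by rewrite addr0 add0r.
- by rewrite MN adjmxD AXh BYh.
- by rewrite NM adjmxD XAh YBh.
Qed.

Lemma mul_adj_eq0_of_mpinvD m n (A B : 'M[C]_(m, n)) :
  A ^t* *m B = 0 -> mpinv (A + B) = mpinv A + mpinv B -> B *m A ^t* = 0.
Proof.
move=> AB0 MPD.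
have XB := mpinv_mul_eq0 AB0; have YA := mpinv_mul_eq0 (adj_mulmx_eq0C AB0).
have := mpinv_mul_idem (A + B).
have -> : mpinv (A + B) *m (A + B) = mpinv A *m A + mpinv B *m B.
  by rewrite MPD mulmxDl !mulmxDr XB YA addr0 add0r.
move/(idempotent_add_orthogonal (mpinv_mul_idem A) (mpinv_mul_idem B)) => QP0.
have /and4P[/eqP BYB _ _ _] := mpinvP B.
(* B is expanded to B B^+ B and A^* to A^+ A A^*, which brings (B^+ B)(A^+ A) = 0 to the middle. *)
rewrite -BYB -(mulmxA B) -mpinv_mul_adj -mulmxA (mulmxA (mpinv B *m B)).
by rewrite QP0 mul0mx mulmx0.
Qed.

End StarOrthogonal.

Theorem theorem2p19 (R : realType) (m n : nat) (A B : 'M[R[i]]_(m, n))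
    (AB0 : A ^t* *m B = 0) :
  mpinv (A + B) = mpinv A + mpinv B <->
  (1%:M - colproj A) *m B *m A ^t* = 0.
Proof.
have -> : (1%:M - colproj A) *m B = B.
  by rewrite mulmxBl mul1mx -mulmxA mpinv_mul_eq0 // mulmx0 subr0.
split; first exact: mul_adj_eq0_of_mpinvD.
exact: mpinvD_of_star_orthogonal.
Qed.
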